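(* Let $\mu$ be a discrete graphical model as in the context, with maximum alphabet size $q$, interaction order $L$ and finite maximum interaction strength $\gamma$. Let $i\in\mathcal V$, and let the target set $\mathcal T_i$ be the set of maximal factors $k$ (of the family $\mathcal K$) with $i\in\partial k$. For $\underline x$ in the perturbation set $\mathcal X_i$ define $$\|\underline x_{\mathcal T_i}\|_{\infty,2}=\max_{c\text{ maximal clique of }\mathcal K,\ c\ni i}\ \sqrt{\sum_{k\in[c]}x_k^2}.$$ Then the Local Learnability Condition at $i$ is satisfied for this norm whenever the Nonsingular Parametrization of Cliques constant $\rho_i^{\rm NPC}$ is nonzero, and for every $\underline x\in\mathcal X_i$, $$\mathbb E\Big[\Big(\sum_{k\in\mathcal K_i}x_kg_{ik}(\underline\sigma_k)\Big)^2\Big]\ \ge\ \rho_i^{\rm NPC}\Big(\frac{e^{-2\gamma}}{q}\Big)^{L-1}\|\underline x_{\mathcal T_i}\|_{\infty,2}^2 .$$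
   Context: Model. $\mathcal V=\{1,\dots,p\}$; each variable $\sigma_i$ takes values in a finite alphabet $\mathcal A_i$, $|\mathcal A_i|\le q$. $\mathcal K$ is a set of factors (the family); each $k\in\mathcal K$ has a vertex set $\partial k\subseteq\mathcal V$ and a basis function $f_k$, a real function of $\underline\sigma_k=(\sigma_j)_{j\in\partial k}$. The model is $\mu(\underline\sigma)=\frac1Z\exp(\sum_{k\in\mathcal K}\theta_k^*f_k(\underline\sigma_k))$ on $\prod_i\mathcal A_i$; $\mathbb E$ is expectation for $\underline\sigma\sim\mu$. $L=\max_{k\in\mathcal K}|\partial k|$. $\mathcal K_i=\{k\in\mathcal K\mid i\in\partial k\}$, $\mathbf K_i=|\mathcal K_i|$, $\underline\theta_i^*=(\theta_k^* )_{k\in\mathcal K_i}$. For $c\subseteq\mathcal V$, $\mathcal A_c=\prod_{j\in c}\mathcal A_j$. Centered functions. Locally centered: $g_{ik}=f_k-\frac1{|\mathcal A_i|}\sum_{\sigma_i\in\mathcal A_i}f_k$ for $k\in\mathcal K_i$, with the standing normalization $\max|g_{ik}|\le1$. Globally centered: $h_k(\underline\sigma_k)=f_k(\underline\sigma_k)+\sum_{\emptyset\ne r\subseteq\partial k}\frac{(-1)^{|r|}}{|\mathcal A_r|}\sum_{\underline\sigma_r\in\mathcal A_r}f_k(\underline\sigma_k)$. Maximum interaction strength: $\gamma=\max_{i\in\mathcal V}\max_{\underline\sigma}|\sum_{k\in\mathcal K_i}\theta^*_kg_{ik}(\underline\sigma_k)|$. Maximal factors and cliques. A maximal factor is a $k\in\mathcal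 K$ such that no $k'\in\mathcal K$ has $\partial k\subsetneq\partial k'$. A maximal clique is a set $c=\partial k$ with $k$ a maximal factor; its span $[c]$ is the set of maximal factors $k$ with $\partial k=c$. Perturbation set. Prior information consists of $\widehat\gamma$ with $\|\underline\theta_i^*\|_1\le\widehat\gamma$ and a constraint set $\mathcal Y_i\subseteq\mathbb R^{\mathbf K_i}$ with $\underline\theta_i^*\in\mathcal Y_i$. Then $\mathcal X_i=\{\underline y_1-\underline y_2\mid\underline y_1,\underline y_2\in\mathcal Y_i,\ \|\underline y_1\|_1\le\widehat\gamma,\ \|\underline y_2\|_1\le\widehat\gamma\}$, and $\mathcal X_i^c$ is its projection onto the coordinates $k\in[c]$. Local Learnability Condition at $i$ for a norm $\|\cdot\|$ and target set $\mathcal T_i\subseteq\mathcal K_i$: there is a constant $\rho_i>0$ with $\mathbb E[(\sum_{k\in\mathcal K_i}x_kg_{ik}(\underline\sigma_k))^2]\ge\rho_i\|\underline x_{\mathcal T_i}\|^2$ for all $\underline x\in\mathcal X_i$, where $\underline x_{\mathcal T_i}=(x_k)_{k\in\mathcal T_i}$. NPC constant. $$\rho_i^{\rm NPC}=\min_{c\ni i,\ c\text{ maximal clique}}\ \ \min_{\underline x_c\in\mathcal X_i^c,\ \|\underline x_c\|_2=1}\ \mathbb E_{\sigma_i}\Big[\sum_{\underline\sigma_{c\setminus i}\in\mathcal A_{c\setminus i}}\Big(\sum_{k\in[c]}x_kh_k(\underline\sigma_k)\Big)^2\Big],$$ the expectation being over the marginal law of $\sigma_i$ under $\mu$.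
   Formalization: In the NPC constant the inner minimum runs over the normalizations x_c/‖x_c‖₂ of all nonzero elements of X_i^c, not only over elements of X_i^c with norm exactly 1; with the literal range the claim is false since X_i is bounded. *)

(* Defs.v *)
From HB Require Import structures.
From mathcomp Require Import all_boot all_order all_algebra.
From mathcomp Require Import all_classical all_reals all_analysis.

Set Implicit Arguments.
Unset Strict Implicit.
Unset Printing Implicit Defensive.

Import Order.TTheory GRing.Theory Num.Theory.

Local Open Scope classical_set_scope.
Local Open Scope ring_scope.

Section PartialConfigurations.
Variables (p : nat) (A : 'I_p -> finType).

Definition config : finType := {dffun forall j : 'I_p, A j}.

(* The product of the alphabets A j over j in c. *)
Definition pconf (c : {set 'I_p}) : finType :=
  {dffun forall j : {j : 'I_p | j \in c}, A (val j)}.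

Definition restr (c : {set 'I_p}) (s : config) : pconf c :=
  finfun (fun j : {j : 'I_p | j \in c} => s (val j)).

Definition update (s : config) (i : 'I_p) (a : A i) : config :=
  finfun (fun j => @dfwith _ _ s i a j).

(* The coordinates of [s] in [c] are replaced by those of [t]. *)
Definition patch (c : {set 'I_p}) (s : config) (t : pconf c) : config :=
  finfun (fun j => match boolP (j \in c) with
                   | AltTrue jc => t (exist _ j jc)
                   | AltFalse _ => s j
                   end).

End PartialConfigurations.

Record graphical_model (R : realType) := GraphicalModel {
  nvar : nat;
  alphabet : 'I_nvar -> finType;
  alphabet_gt0 : forall j, (0 < #|alphabet j|)%N;
  factor : finType;
  scope : factor -> {set 'I_nvar};
  basis : forall k : factor, pconf alphabet (scope k) -> R;
  param : factor -> R
}.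

Section Norms.
Variables (R : realType) (I : finType).

Definition l1norm (x : {ffun I -> R}) : R := \sum_k `|x k|.

Definition l2norm (x : {ffun I -> R}) : R := Num.sqrt (\sum_k x k ^+ 2).

(* The vectors of norm 1 on the rays spanned by the nonzero points of [S]. *)
Definition unit_directions (S : set {ffun I -> R}) : set {ffun I -> R} :=
  [set x | l2norm x = 1 /\ exists2 t : R, 0 < t & S (t *: x)].

Lemma l2normZ (t : R) (x : {ffun I -> R}) :
  0 <= t -> l2norm (t *: x) = t * l2norm x.
Proof.
move=> t0; rewrite /l2norm.
under eq_bigr => k _ do rewrite ffunE exprMn.
by rewrite -mulr_sumr sqrtrM ?sqr_ge0// sqrtr_sqr ger0_norm.
Qed.

Lemma sub_unit_directions (S : set {ffun I -> R}) :
  [set x | S x /\ l2norm x = 1] `<=` unit_directions S.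
Proof. by move=> x [Sx x1]; split=> //; exists 1; rewrite ?scale1r. Qed.

Lemma unit_directionsE (S : set {ffun I -> R}) :
  (forall x, S x -> l2norm x != 0 -> S ((l2norm x)^-1 *: x)) ->
  unit_directions S = [set x | S x /\ l2norm x = 1].
Proof.
move=> HS; apply/seteqP; split; last exact: sub_unit_directions.
move=> x [x1 [t t0 Stx]]; split=> //.
have nt : l2norm (t *: x) = t by rewrite l2normZ ?ltW// x1 mulr1.
have := HS _ Stx; rewrite nt scalerA mulVf ?gt_eqF// scale1r; exact.
Qed.

End Norms.

Section Model.
Variables (R : realType) (M : graphical_model R).

Let V := 'I_(nvar M).
Let A := @alphabet R M.
Let K := factor M.
Let cfg := config A.

(* The value of the basis function of [k] on the restriction of [s]. *)
Definition fval (k : K) (s : cfg) : R := basis (restr (scope k) s).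

Definition weight (s : cfg) : R := expR (\sum_(k : K) param k * fval k s).

Definition partition_function : R := \sum_(s : cfg) weight s.

Definition gibbs (s : cfg) : R := weight s / partition_function.

Definition expect (F : cfg -> R) : R := \sum_(s : cfg) gibbs s * F s.

Definition interaction_order : nat := \max_(k : K) #|scope k|.

(* The centered functions are viewed as functions of the whole configuration;
   they only depend on its coordinates in [scope k]. *)
Definition local_centered (i : V) (k : K) (s : cfg) : R :=
  fval k s - #|A i|%:R^-1 * \sum_(a : A i) fval k (update s a).

Definition global_centered (k : K) (s : cfg) : R :=
  fval k s
  + \sum_(r : {set V} | (r != finset.set0) && (r \subset scope k))
      (-1) ^+ #|r| / #|pconf A r|%:R
      * \sum_(t : pconf A r) fval k (patch s t).

Definition normalized : Prop :=
  forall (i : V) (k : K), i \in scope k ->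
  forall s : cfg, `|local_centered i k s| <= 1.

Definition interaction_strength : R :=
  \big[Order.max/0]_(i : V) \big[Order.max/0]_(s : cfg)
    `| \sum_(k : K | i \in scope k) param k * local_centered i k s |.

Definition maximal_factor (k : K) : bool :=
  ~~ [exists k' : K, scope k \proper scope k'].

Definition maximal_clique (c : {set V}) : bool :=
  [exists k : K, maximal_factor k && (scope k == c)].

Definition span_of (c : {set V}) : {set K} :=
  finset (fun k : K => maximal_factor k && (scope k == c)).

Section AtVertex.
Variable i : V.

Definition factor_at : finType := {k : K | i \in scope k}.

Definition param_at : {ffun factor_at -> R} := [ffun k => param (val k)].

Definition subvec (T : {set factor_at}) (x : {ffun factor_at -> R}) :
    {ffun {k : factor_at | k \in T} -> R} :=
  [ffun k => x (val k)].

Definition perturbation_set (Y : set {ffun factor_at -> R}) (gammah : R) :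
    set {ffun factor_at -> R} :=
  [set x | exists y1 y2, [/\ Y y1, Y y2, l1norm y1 <= gammah,
                             l1norm y2 <= gammah & x = y1 - y2]].

Definition energy (x : {ffun factor_at -> R}) : R :=
  expect (fun s => (\sum_(k : factor_at)
                      x k * local_centered i (val k) s) ^+ 2).

Definition local_learnability (T : {set factor_at})
    (N : {ffun {k : factor_at | k \in T} -> R} -> R)
    (X : set {ffun factor_at -> R}) : Prop :=
  exists2 rho : R, 0 < rho &
    forall x, X x -> rho * N (subvec T x) ^+ 2 <= energy x.

Definition maximal_targets : {set factor_at} :=
  finset (fun k : factor_at => maximal_factor (val k)).

Definition norm_inf2
    (x : {ffun {k : factor_at | k \in maximal_targets} -> R}) : R :=
  \big[Order.max/0]_(c : {set V} | maximal_clique c && (i \in c))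
    Num.sqrt (\sum_(k | val (val k) \in span_of c) x k ^+ 2).

(* For c containing i this is the whole span of c, seen inside the factors
   at i. *)
Definition span_at (c : {set V}) : {set factor_at} :=
  finset (fun k : factor_at => val k \in span_of c).

(* When i is in c, the integrand depends on [s] through its coordinate i only:
   the remaining coordinates in c = scope k are those of [t].  The expectation
   is thus taken over the marginal law of that coordinate. *)
Definition npc_form (c : {set V})
    (x : {ffun {k : factor_at | k \in span_at c} -> R}) : R :=
  expect (fun s => \sum_(t : pconf A (c :\ i))
    (\sum_k x k * global_centered (val (val k)) (patch s t)) ^+ 2).

(* The minima are infima in the extended reals, hence +oo over an empty range.
   The inner one runs over the normalized nonzero elements of the projection
   of X; by [unit_directionsE] these are the elements of norm 1 of this
   projection as soon as it contains the normalizations of its nonzero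
   elements.  The perturbation sets are bounded, so that they may contain
   few unit vectors or none; minimizing over these alone would then say
   nothing on the shorter elements. *)
Definition npc_constant (X : set {ffun factor_at -> R}) : \bar R :=
  \big[Order.min/+oo%E]_(c : {set V} | maximal_clique c && (i \in c))
    ereal_inf [set (npc_form x)%:E | x in
                 unit_directions [set subvec (span_at c) y | y in X]].

End AtVertex.
End Model.

(* Main.v *)
Require Import Defs.
From HB Require Import structures.
From mathcomp Require Import all_boot all_order all_algebra.
From mathcomp Require Import all_classical all_reals all_analysis.
From mathcomp Require Import ring lra.

Import Order.TTheory GRing.Theory Num.Theory.

Local Open Scope ring_scope.

Set Implicit Arguments.
Unset Strict Implicit.
Unset Printing Implicit Defensive.

(* The energy of x is the second moment of D = sum_k x_k g_ik.  Flipping one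
   spin changes the weight of a configuration by a factor at most e^{2 gamma},
   so integrating out a spin costs at most e^{-2 gamma} / q compared with
   summing over its values: with c a maximal clique containing i, E[D^2] is at
   least (e^{-2 gamma} / q)^{|c| - 1} times the expectation of the sum of D^2
   over the spins of c \ i.  Under the uniform measure on these spins, centering
   in all of them is an orthogonal projection, hence decreases this sum; it
   kills g_ik when c is not contained in the scope of k and, by maximality of
   c, turns the remaining g_ik into the h_k with k in [c]. *)

(** * Sums over the fibers of coordinate projections *)

Section Fibers.
Variables (p : nat) (A : 'I_p -> finType).
Implicit Types (c d : {set 'I_p}) (s u v : config A) (j : 'I_p).

Definition agree_off c s u := [forall j, (j \in c) || (u j == s j)].

Lemma agree_offP c s u :
  reflect (forall j, j \notin c -> u j = s j) (agree_off c s u).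
Proof.
apply: (iffP forallP) => [H j jc|H j].
  by have := H j; rewrite (negbTE jc) => /eqP.
by case: (boolP (j \in c)) => //= jc; rewrite H.
Qed.

Lemma agree_off_sym c s u : agree_off c s u = agree_off c u s.
Proof. by apply/agree_offP/agree_offP => H j jc; rewrite H. Qed.

Lemma patch_in c s (t : pconf A c) j (jc : j \in c) :
  Defs.patch s t j = t (exist _ j jc).
Proof.
rewrite /Defs.patch ffunE; case: {-}_ / boolP => jc'; last by rewrite jc in jc'.
by rewrite (bool_irrelevance jc' jc).
Qed.

Lemma patch_out c s (t : pconf A c) j : j \notin c -> Defs.patch s t j = s j.
Proof.
move=> jc; rewrite /Defs.patch ffunE; case: {-}_ / boolP => // jc'.
by rewrite jc' in jc.
Qed.

Lemma restr_patch c s (t : pconf A c) : restr c (Defs.patch s t) = t.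
Proof. by apply/ffunP => -[j jc]; rewrite /restr ffunE (patch_in _ _ jc). Qed.

Lemma patch_restr_in c s u j : j \in c -> Defs.patch s (restr c u) j = u j.
Proof. by move=> jc; rewrite (patch_in _ _ jc) /restr ffunE. Qed.

Lemma update_same s j (a : A j) : update s a j = a.
Proof. by rewrite /update ffunE dfwithin. Qed.

Lemma update_diff s j (a : A j) j' : j' != j -> update s a j' = s j'.
Proof. by move=> jj; rewrite /update ffunE dfwithout// eq_sym. Qed.

Variable R : realType.
Implicit Types F G : config A -> R.

(** Summing over full configurations, instead of over [pconf A c], gives a function of the same type
    as [F], so that sums over disjoint sets of coordinates compose. *)
Definition fibersum c F s : R := \sum_(u | agree_off c s u) F u.

Lemma sum_patch c F s : \sum_(t : pconf A c) F (Defs.patch s t) = fibersum c F s.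
Proof.
rewrite /fibersum (reindex_onto (@Defs.patch _ _ c s) (@restr _ _ c)) /=.
  apply: eq_bigl => t; rewrite restr_patch eqxx andbT; apply/esym/agree_offP.
  by move=> j jc; rewrite patch_out.
move=> u /agree_offP su; apply/ffunP => j.
by case: (boolP (j \in c)) => jc; [rewrite patch_restr_in|rewrite patch_out// su].
Qed.

Lemma sum_update j F s :
  \sum_(a : A j) F (update s a) = fibersum [set j] F s.
Proof.
rewrite /fibersum (reindex_onto (fun a : A j => update s a) (fun u => u j)) /=.
  apply: eq_bigl => a; rewrite update_same eqxx andbT; apply/esym/agree_offP.
  by move=> j'; rewrite inE => jj; rewrite update_diff.
move=> u /agree_offP su; apply/ffunP => j'.
have [->|jj] := eqVneq j' j; first by rewrite update_same.
by rewrite update_diff// su// inE.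
Qed.

Lemma fibersumU c d F s : [disjoint c & d] ->
  fibersum (c :|: d) F s = fibersum c (fibersum d F) s.
Proof.
move=> cd; rewrite /fibersum.
rewrite (exchange_big_dep (fun u => agree_off (c :|: d) s u)) /=; last first.
  move=> v u /agree_offP sv /agree_offP vu; apply/agree_offP => j.
  by rewrite inE negb_or => /andP[jc jd]; rewrite vu// sv.
apply: eq_bigr => u /agree_offP su.
(* The only intermediate configuration between [s] and [u] follows [u] on [c] and [s] elsewhere. *)
rewrite (big_pred1 (Defs.patch s (restr c u)))// => v /=.
apply/andP/eqP => [[/agree_offP sv /agree_offP vu]|->].
  apply/ffunP => j; case: (boolP (j \in c)) => jc.
    by rewrite patch_restr_in// vu// (disjointFr cd jc).
  by rewrite patch_out// sv.
split; apply/agree_offP => j jc; first by rewrite patch_out.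
case: (boolP (j \in c)) => jc'; first by rewrite patch_restr_in.
by rewrite patch_out// su// inE negb_or jc'.
Qed.

Lemma fibersum_cst c s : fibersum c (fun=> 1) s = #|pconf A c|%:R.
Proof. by rewrite -sum_patch sumr_const. Qed.

Lemma fibersum_cst1 j s : fibersum [set j] (fun=> 1) s = #|A j|%:R.
Proof. by rewrite -sum_update sumr_const. Qed.

Lemma fibersumZ c (a : R) F s :
  fibersum c (fun u => a * F u) s = a * fibersum c F s.
Proof. by rewrite /fibersum mulr_sumr. Qed.

Lemma fibersumB c F G s :
  fibersum c (fun u => F u - G u) s = fibersum c F s - fibersum c G s.
Proof. by rewrite /fibersum sumrB. Qed.

Lemma le_fibersum c F G s :
  (forall u, F u <= G u) -> fibersum c F s <= fibersum c G s.
Proof. by move=> FG; apply: ler_sum. Qed.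

Lemma fibersum0 F s : fibersum finset.set0 F s = F s.
Proof.
rewrite /fibersum (big_pred1 s)// => u /=; apply/agree_offP/eqP => [H|->//].
by apply/ffunP => j; rewrite H// inE.
Qed.

Lemma card_pconf0 s : #|pconf A finset.set0|%:R = 1 :> R.
Proof. by rewrite -(fibersum_cst _ s) fibersum0. Qed.

(** Cardinals are fiber sums of 1, with [s] as base point, so the product rule comes from
    [fibersumU]. *)
Lemma card_pconfU1 j c s : j \notin c ->
  #|pconf A (j |: c)|%:R = #|A j|%:R * #|pconf A c|%:R :> R.
Proof.
move=> jc; rewrite -!(fibersum_cst _ s) -fibersumZ finset.setUC.
rewrite fibersumU 1?disjoint_sym ?finset.disjoints1//.
by apply: eq_bigr => u _; rewrite mulr1 fibersum_cst1.
Qed.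

(** * Centering in a set of coordinates *)

Definition center1 j F s : R :=
  F s - #|A j|%:R^-1 * \sum_(a : A j) F (update s a).

(* Inclusion-exclusion form of the composite of the center1 j for j in c. *)
Definition center c F s : R :=
  \sum_(r : {set 'I_p} | r \subset c)
    (-1) ^+ #|r| / #|pconf A r|%:R * fibersum r F s.

(** The subsets of [j |: c] come in pairs [r], [j |: r] with [r] inside [c]; the second member
    carries the average over [j] subtracted in [center1]. *)
Lemma centerU1 j c F s : j \notin c ->
  center (j |: c) F s = center c (center1 j F) s.
Proof.
move=> jc; rewrite /center (bigID (fun r : {set 'I_p} => j \in r)) /= addrC.
rewrite (eq_bigl (fun r : {set 'I_p} => r \subset c)); last first.
  move=> r /=; apply/andP/idP => [[rc jr]|rc].
    apply/fintype.subsetP => x xr; have /fintype.subsetP/(_ _ xr) := rc.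
    by rewrite !inE => /orP[/eqP xj|//]; rewrite -xj xr in jr.
  split; first by rewrite (fintype.subset_trans rc)// finset.subsetUr.
  by apply: contra jc; apply/fintype.subsetP.
rewrite [X in _ + X](reindex_onto (fun r => j |: r) (fun r => r :\ j)) /=; last first.
  by move=> r /andP[_ jr]; rewrite finset.setD1K.
rewrite [X in _ + X](eq_bigl (fun r : {set 'I_p} => r \subset c)); last first.
  move=> r; rewrite finset.setU11 andbT; apply/andP/idP => [[rc /eqP jr]|rc].
    apply/fintype.subsetP => x xr; have /fintype.subsetP/(_ x) := rc.
    rewrite !inE xr orbT => /(_ isT) /orP[/eqP xj|//].
    by move: xr; rewrite -jr xj !inE eqxx.
  rewrite finset.setUS// finset.setU1K//; apply: contra jc; exact/fintype.subsetP.
rewrite -big_split /=; apply: eq_bigr => r rc.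
have jr : j \notin r by apply: contra jc; exact/fintype.subsetP.
rewrite (card_pconfU1 s)// finset.cardsU1 jr exprS mulN1r.
rewrite fibersumB fibersumZ mulrBr; congr (_ + _).
rewrite finset.setUC fibersumU 1?disjoint_sym ?disjoints1//.
rewrite (_ : fibersum r (fibersum [set j] F) s =
  fibersum r (fun u => \sum_(a : A j) F (update u a)) s); last first.
  by apply: eq_bigr => u _; rewrite sum_update.
by rewrite invfM !mulNr; ring.
Qed.

Lemma center_sum (I : finType) c (x : I -> R) (G : I -> config A -> R) s :
  center c (fun u => \sum_k x k * G k u) s = \sum_k x k * center c (G k) s.
Proof.
rewrite /center; under [RHS]eq_bigr do rewrite mulr_sumr.
rewrite exchange_big /=; apply: eq_bigr => r _.
rewrite /fibersum exchange_big /= mulr_sumr; apply: eq_bigr => k _.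
by rewrite -mulr_sumr mulrCA.
Qed.

(** Centering in [j] may be done first, and [F] equals its own average over [j]. *)
Lemma center_indep c j F s : j \in c ->
  (forall u (a : A j), F (update u a) = F u) -> center c F s = 0.
Proof.
move=> jc HF; rewrite -(finset.setD1K jc) centerU1 ?setD11//.
rewrite /center big1// => r _; rewrite /fibersum big1 ?mulr0// => u _.
rewrite /center1; under eq_bigr do rewrite HF.
rewrite sumr_const -[F u *+ _]mulr_natl mulrA mulVf ?mul1r ?subrr//.
by rewrite pnatr_eq0 -lt0n; apply/card_gt0P; exists (s j).
Qed.

Lemma center0 F s : center finset.set0 F s = F s.
Proof.
rewrite /center (big_pred1 finset.set0); last by move=> r; rewrite finset.subset0.
by rewrite cards0 expr0 (card_pconf0 s) divr1 mul1r fibersum0.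
Qed.

(** A variance is at most a second moment: with [m] the mean over the n values of coordinate [j],
    the two sides differ by n m^2. *)
Lemma fibersum_center1_sqr j F s :
  fibersum [set j] (fun u => center1 j F u ^+ 2) s <=
  fibersum [set j] (fun u => F u ^+ 2) s.
Proof.
rewrite -!sum_update; set m := #|A j|%:R^-1 * \sum_(a : A j) F (update s a).
have n0 : (#|A j|%:R : R) != 0.
  by rewrite pnatr_eq0 -lt0n; apply/card_gt0P; exists (s j).
have upd2 (a b : A j) : update (update s a) b = update s b.
  apply/ffunP => j'; have [->|jj] := eqVneq j' j; first by rewrite !update_same.
  by rewrite !update_diff.
have -> : \sum_(a : A j) center1 j F (update s a) ^+ 2 =
    \sum_(a : A j) (F (update s a) ^+ 2 - 2 * m * F (update s a) + m ^+ 2).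
  apply: eq_bigr => a _; rewrite /center1; under eq_bigr do rewrite upd2.
  by rewrite -/m; ring.
rewrite big_split sumrB /= -mulr_sumr sumr_const -[m ^+ 2 *+ _]mulr_natl.
have -> : \sum_(a : A j) F (update s a) = #|A j|%:R * m by rewrite mulVKf.
have : 0 <= #|A j|%:R * m ^+ 2 by rewrite mulr_ge0 ?sqr_ge0.
by nra.
Qed.

Lemma set_U1_ind (P : {set 'I_p} -> Prop) :
  P finset.set0 -> (forall j c, j \notin c -> P c -> P (j |: c)) ->
  forall c, P c.
Proof.
move=> P0 PU c; have [n] := ubnP #|c|; elim: n c => // n IH c.
have [->//|[j jc]] := finset.set_0Vmem c; rewrite (cardsD1 j) jc ltnS => cn.
by rewrite -(finset.setD1K jc); apply: PU; [rewrite finset.setD11|exact: IH].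
Qed.

Lemma fibersum_center_sqr c F s :
  fibersum c (fun u => center c F u ^+ 2) s <=
  fibersum c (fun u => F u ^+ 2) s.
Proof.
elim/set_U1_ind: c F s => [F s|j c jc IH F s]; first by rewrite !fibersum0 center0.
have jc' : [disjoint [set j] & c] by rewrite finset.disjoints1.
(* Coordinate [j] is centered before those of [c]: the induction hypothesis, applied to
   [center1 j F], handles the sum over [c]. *)
rewrite fibersumU// (@le_trans _ _ (fibersum (j |: c) (fun u => center1 j F u ^+ 2) s))//.
  rewrite [leRHS]fibersumU//; apply: le_fibersum => v.
  apply: le_trans (IH _ _); apply: le_fibersum => u.
  by rewrite centerU1.
(* The order of summation is now reversed, so that the inner sum runs over [j] alone. *)
rewrite finset.setUC !(fibersumU _ _ _ (c := c)) 1?disjoint_sym//.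
by apply: le_fibersum => v; exact: fibersum_center1_sqr.
Qed.

End Fibers.

(** * Locally and globally centered basis functions *)

Section Model.
Variables (R : realType) (M : graphical_model R).
Let A := @alphabet R M.
Implicit Types (s u : config A) (k : Defs.factor M) (c : {set 'I_(nvar M)}).

Lemma fval_update k s j (a : A j) :
  j \notin scope k -> fval k (update s a) = fval k s.
Proof.
move=> jk; rewrite /fval; congr (Defs.basis _); apply/ffunP => -[l lk].
rewrite /restr !ffunE /= dfwithout//.
by apply: contra jk => /eqP ->.
Qed.

(** The empty set contributes the uncentered term [fval k s]. *)
Lemma global_centeredE k s : global_centered k s = center (scope k) (fval k) s.
Proof.
rewrite /global_centered /center [RHS](bigD1 finset.set0) ?finset.sub0set//=.
rewrite cards0 expr0 (card_pconf0 _ s) divr1 mul1r fibersum0; congr (_ + _).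
by apply: eq_big => [r|r _]; rewrite ?sum_patch// andbC.
Qed.

(** By definition [local_centered i k] is [center1 i (fval k)], so it suffices to split [i] off the
    scope. *)
Lemma global_centered_local i k s : i \in scope k ->
  global_centered k s = center (scope k :\ i) (local_centered i k) s.
Proof.
by move=> ik; rewrite global_centeredE -[in LHS](finset.setD1K ik) centerU1 ?finset.setD11.
Qed.

Lemma local_centered_update i k s j (a : A j) : j \notin scope k ->
  i \in scope k -> local_centered i k (update s a) = local_centered i k s.
Proof.
move=> jk ik; rewrite /local_centered fval_update//; congr (_ - _ * _).
apply: eq_bigr => b _; rewrite -(fval_update (update s b) a jk).
congr (fval k _); apply/ffunP => l.
have [li|li] := eqVneq l i; last first.
  rewrite update_diff//; have [->|lj] := eqVneq l j; first by rewrite !update_same.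
  by rewrite !update_diff.
subst l; rewrite update_same update_diff ?update_same//.
by apply: contraNneq jk => <-.
Qed.

(** * Gibbs weights under changes of spins *)

Lemma interaction_strength_ge i s :
  `| \sum_(k | i \in scope k) param k * local_centered i k s | <=
  interaction_strength M.
Proof.
apply: le_trans (le_bigmax _ _ i); exact: le_trans (le_bigmax _ _ s).
Qed.

Lemma interaction_strength_ge0 : 0 <= interaction_strength M.
Proof. exact: bigmax_ge_id. Qed.

(** The average over spin [j] does not see the value at [j], so the log-weight changes by a
    difference of two centered sums, each at most gamma in absolute value. *)
Lemma weight_update_le s j (a : A j) :
  weight (update s a) <= expR (2 * interaction_strength M) * weight s.
Proof.
rewrite /weight -expRD ler_expR.
pose H u := \sum_(k | j \in scope k) param k * local_centered j k u.
have : \sum_k param k * fval k (update s a) - \sum_k param k * fval k s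
    = H (update s a) - H s.
  rewrite -!sumrB [RHS]big_mkcond /=; apply: eq_bigr => k _.
  case: ifPn => jk; last by rewrite fval_update// subrr.
  rewrite -!mulrBr; congr (_ * _); rewrite /local_centered.
  have -> : \sum_(b : A j) fval k (update (update s a) b) =
      \sum_(b : A j) fval k (update s b).
    apply: eq_bigr => b _; congr (fval k _); apply/ffunP => l.
    have [->|lj] := eqVneq l j; first by rewrite !update_same.
    by rewrite !update_diff.
  by ring.
have := interaction_strength_ge j (update s a).
have := interaction_strength_ge j s.
by rewrite -/(H s) -/(H (update s a)) !ler_norml; lra.
Qed.

Lemma weight_ge0 s : 0 <= weight s. Proof. exact: expR_ge0. Qed.

Lemma gibbs_ge0 s : 0 <= gibbs s.
Proof. by rewrite divr_ge0 ?weight_ge0// sumr_ge0// => u _; rewrite weight_ge0. Qed.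

Variables (q : nat) (card_le : forall j, (#|A j| <= q)%N).

(** Each coordinate of [c] has at most [q] values, and each change of value costs at most the factor
    of [weight_update_le]. *)
Lemma fibersum_gibbs_le c s : fibersum c (@gibbs R M) s <=
  (q%:R * expR (2 * interaction_strength M)) ^+ #|c| * gibbs s.
Proof.
elim/set_U1_ind: c s => [s|j c jc IH s].
  by rewrite fibersum0 cards0 expr0 mul1r.
rewrite fibersumU ?finset.disjoints1// finset.cardsU1 jc exprSr.
set B := _ * expR _.
have B0 : 0 <= B by rewrite mulr_ge0 ?expR_ge0.
apply: (le_trans (le_fibersum _ _ IH)); rewrite fibersumZ -mulrA.
rewrite ler_wpM2l ?exprn_ge0// -sum_update.
apply: (@le_trans _ _ (\sum_(a : A j) expR (2 * interaction_strength M) * gibbs s)).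
  apply: ler_sum => a _; rewrite /gibbs mulrA ler_wpM2r ?weight_update_le//.
  by rewrite invr_ge0 sumr_ge0// => u _; rewrite weight_ge0.
rewrite sumr_const -[X in X <= _]mulr_natl /B mulrA ler_wpM2r ?gibbs_ge0//.
by rewrite ler_wpM2r ?expR_ge0// ler_nat card_le.
Qed.

Hypothesis q_gt0 : (0 < q)%N.
Let kappa := expR (- 2 * interaction_strength M) / q%:R.

(* The relation agree_off c is symmetric, so exchanging the sums moves fibersum
   from F to the Gibbs weights. *)
Lemma expect_fibersum_le c (F : config A -> R) : (forall s, 0 <= F s) ->
  kappa ^+ #|c| * expect (fibersum c F) <= expect F.
Proof.
move=> F0; rewrite /expect /fibersum.
under eq_bigr do rewrite mulr_sumr.
rewrite (exchange_big_dep predT) //= mulr_sumr; apply: ler_sum => u _.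
rewrite -mulr_suml mulrA ler_wpM2r//.
under eq_bigl do rewrite agree_off_sym.
have /(ler_wpM2l _) : fibersum c (@gibbs R M) u <= _ := fibersum_gibbs_le c u.
move=> /(_ (kappa ^+ #|c|)) H; apply: le_trans (H _) _.
  by rewrite exprn_ge0// divr_ge0 ?expR_ge0.
rewrite mulrA -exprMn (_ : kappa * _ = 1) ?expr1n ?mul1r//.
by rewrite /kappa mulrA divfK ?pnatr_eq0 -?lt0n// -expRD mulNr addNr expR0.
Qed.

(** * Clique forms and the NPC constant at a vertex *)

Variable i : 'I_(nvar M).
Implicit Types x : {ffun factor_at i -> R}.

Lemma center_clique c x s : maximal_clique c -> i \in c ->
  center (c :\ i) (fun u => \sum_k x k * local_centered i (val k) u) s =
  \sum_k subvec (span_at i c) x k * global_centered (val (val k)) s.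
Proof.
move=> /existsP[k0 /andP[k0max /eqP k0c]] ic.
rewrite center_sum (bigID (fun k : factor_at i => k \in span_at i c)) /= [X in _ + X]big1.
  rewrite addr0 big_sub; apply: eq_bigr => -[k kc] _ /=; rewrite ffunE /=.
  move: kc; rewrite !inE => /andP[_ /eqP kc].
  by rewrite (global_centered_local _ (valP k)) kc.
move=> k; rewrite !inE => kc.
(* If the scope of [k] contained [c], maximality would make them equal and put [k] in the span. The
   missing [j] differs from [i], which lies in the scope, so centering in [j] kills the term. *)
have /fintype.subsetPn[j jc jk] : ~~ (c \subset scope (val k)).
  apply: contra kc => ck.
  have ckE : scope (val k) = c.
    apply/eqP; rewrite eq_sym finset.eqEproper ck /=; move: k0max; rewrite -k0c.
    by apply: contra => H; apply/existsP; exists (val k).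
  by rewrite ckE eqxx andbT /maximal_factor ckE -k0c.
rewrite (center_indep _ (j := j)) ?mulr0//.
  rewrite !inE jc andbT; apply: contraNneq jk => ->; exact: (valP k).
by move=> u a; rewrite local_centered_update// (valP k).
Qed.

Lemma npc_form_ge0 c (x : {ffun {k : factor_at i | k \in span_at i c} -> R}) :
  0 <= npc_form x.
Proof.
apply: sumr_ge0 => s _; rewrite mulr_ge0 ?gibbs_ge0// sumr_ge0// => t _.
exact: sqr_ge0.
Qed.

Lemma npc_form_le_energy c x : maximal_clique c -> i \in c ->
  kappa ^+ (interaction_order M - 1) * npc_form (subvec (span_at i c) x) <=
  energy x.
Proof.
move=> cmax ic; pose F s := (\sum_k x k * local_centered i (val k) s) ^+ 2.
apply: (@le_trans _ _ (kappa ^+ #|c :\ i| * expect (fibersum (c :\ i) F))); last first.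
  by apply: expect_fibersum_le => s; exact: sqr_ge0.
have npc_le : npc_form (subvec (span_at i c) x) <= expect (fibersum (c :\ i) F).
  rewrite /npc_form /expect; apply: ler_sum => s _; rewrite ler_wpM2l ?gibbs_ge0//.
  rewrite (sum_patch _ (fun u => (\sum_k subvec (span_at i c) x k *
    global_centered (val (val k)) u) ^+ 2)).
  apply: le_trans (fibersum_center_sqr _ _ _); apply: le_fibersum => u.
  by rewrite center_clique.
have k0 : 0 <= kappa by rewrite divr_ge0 ?expR_ge0.
(* Cliques have at most L vertices, one of which is [i]; since [kappa] is at most 1, replacing the
   exponent by L - 1 only weakens the bound. *)
have k1 : kappa <= 1.
  rewrite ler_pdivrMr ?ltr0n// mul1r (@le_trans _ _ 1) ?ler1n//.
  rewrite -[leRHS]expR0 ler_expR; have := interaction_strength_ge0; lra.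
apply: ler_pM => //; [by rewrite exprn_ge0|exact: npc_form_ge0|].
apply: ler_wiXn2l => //.
have /existsP[k /andP[_ /eqP kc]] := cmax.
have := leq_bigmax (F := fun k => #|scope k|) k; rewrite -/(interaction_order M).
by rewrite kc (cardsD1 i) ic add1n; case: interaction_order => // n; rewrite subn1.
Qed.

Lemma npc_formZ c t (x : {ffun {k : factor_at i | k \in span_at i c} -> R}) :
  npc_form (t *: x) = t ^+ 2 * npc_form x.
Proof.
rewrite /npc_form /expect mulr_sumr; apply: eq_bigr => s _; rewrite mulrCA.
congr (_ * _); rewrite mulr_sumr; apply: eq_bigr => u _.
rewrite -exprMn mulr_sumr; congr (_ ^+ 2); apply: eq_bigr => k _.
by rewrite !ffunE mulrA.
Qed.

Lemma npc_constant_ge0 (X : set {ffun factor_at i -> R}) :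
  (0 <= npc_constant X)%E.
Proof.
apply: le_bigmin => [|c _]; first exact: leey.
by apply: le_ereal_inf_tmp => _ [x _ <-]; rewrite lee_fin npc_form_ge0.
Qed.

(** The sums run over two different subtypes but the same factors, since every factor in a span is
    maximal. *)
Lemma norm_inf2E x : norm_inf2 (subvec (maximal_targets i) x) =
  \big[Order.max/0]_(c | maximal_clique c && (i \in c))
    l2norm (subvec (span_at i c) x).
Proof.
apply: eq_bigr => c _; rewrite /l2norm; congr Num.sqrt.
under eq_bigr do rewrite ffunE; under [RHS]eq_bigr do rewrite ffunE.
rewrite -(big_sub_cond (mem (maximal_targets i))
  (fun k : factor_at i => val k \in span_of c)
  (fun k : factor_at i => x k ^+ 2)).
rewrite -(big_sub (mem (span_at i c)) (fun k : factor_at i => x k ^+ 2)).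
by apply: eq_bigl => k; rewrite !inE andbA andbb.
Qed.

(** Both sides are homogeneous of degree 2 in the projection of [x], which can thus be
    normalized. *)
Lemma npc_constant_le c (X : set {ffun factor_at i -> R}) x :
  maximal_clique c -> i \in c -> X x ->
  (npc_constant X * (l2norm (subvec (span_at i c) x) ^+ 2)%:E <=
    (npc_form (subvec (span_at i c) x))%:E)%E.
Proof.
move=> cmax ic Xx; set y := subvec _ x; set n := l2norm y.
(* A zero projection has no direction; the left side is then 0 even if the constant is infinite. *)
have [n0|n0] := eqVneq n 0.
  by rewrite n0 expr0n /= mule0 lee_fin npc_form_ge0.
have n_gt0 : 0 < n by rewrite lt_neqAle eq_sym n0 sqrtr_ge0.
have -> : npc_form y = npc_form (n^-1 *: y) * n ^+ 2.
  by rewrite npc_formZ mulrC mulrA -exprMn mulfV// expr1n mul1r.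
rewrite [leRHS]EFinM lee_wpmul2r ?lee_fin ?sqr_ge0//.
apply: (@le_trans _ _ (ereal_inf [set (npc_form x)%:E | x in
    unit_directions [set subvec (span_at i c) y | y in X]]))%classic.
  by apply: bigmin_le_cond; rewrite cmax.
apply: ereal_inf_lbound; exists (n^-1 *: y) => //; split.
  by rewrite l2normZ ?invr_ge0 ?ltW// mulVf.
by exists n => //; exists x => //; rewrite scalerA mulfV// scale1r.
Qed.

Lemma npc_constant_le_energy (X : set {ffun factor_at i -> R}) x : X x ->
  (npc_constant X * (kappa ^+ (interaction_order M - 1) *
     norm_inf2 (subvec (maximal_targets i) x) ^+ 2)%:E <= (energy x)%:E)%E.
Proof.
move=> Xx; rewrite norm_inf2E.
set n := \big[_/_]_(_ | _) _.
(* The maximum is either its default value 0 or attained, so the bound for a single clique is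
   enough. *)
have : n = 0 \/ exists2 c, maximal_clique c && (i \in c) &
    n = l2norm (subvec (span_at i c) x).
  rewrite /n; elim/big_ind: _ => [|u v Hu Hv|c Hc]; first by left.
    by rewrite /Order.max; case: ifP.
  by right; exists c.
case=> [->|[c /andP[cmax ic] ->]].
  rewrite expr0n /= mulr0 mule0 lee_fin; apply: sumr_ge0 => s _.
  by rewrite mulr_ge0 ?gibbs_ge0 ?sqr_ge0.
apply: (@le_trans _ _ (kappa ^+ (interaction_order M - 1) *
    npc_form (subvec (span_at i c) x))%:E); last first.
  by rewrite lee_fin npc_form_le_energy.
rewrite !EFinM muleCA lee_wpmul2l//; last exact: npc_constant_le.
by rewrite lee_fin exprn_ge0// divr_ge0 ?expR_ge0.
Qed.

End Model.

Unset Implicit Arguments.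

Theorem proposition1 (R : realType) (M : graphical_model R) (q : nat)
    (Hq : forall j : 'I_(nvar M), (#|alphabet j| <= q)%N)
    (Hnorm : normalized M)
    (i : 'I_(nvar M))
    (gammah : R) (Y : set {ffun factor_at i -> R})
    (Htheta1 : l1norm (param_at i) <= gammah)
    (HthetaY : Y (param_at i)) :
  let X := perturbation_set Y gammah in
  let gamma := interaction_strength M in
  let L := interaction_order M in
  (npc_constant X <> 0%E -> local_learnability (@norm_inf2 R M i) X) /\
  (forall x : {ffun factor_at i -> R}, X x ->
    (npc_constant X
       * ((expR (- 2 * gamma) / q%:R) ^+ (L - 1)
          * norm_inf2 (subvec (maximal_targets i) x) ^+ 2)%:E
     <= (energy x)%:E)%E).
Proof.
move=> X gamma L.
have q_gt0 : (0 < q)%N := leq_trans (alphabet_gt0 i) (Hq i).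
have bound x : X x -> _ := @npc_constant_le_energy R M q Hq q_gt0 i X x.
split=> //.
have kappa_gt0 : 0 < (expR (- 2 * gamma) / q%:R) ^+ (L - 1).
  by rewrite exprn_gt0// divr_gt0 ?expR_gt0 ?ltr0n.
have := npc_constant_ge0 X; move: bound; rewrite -/gamma -/L.
(* Nonnegativity excludes minus infinity and makes a nonzero real constant positive. *)
case: (npc_constant X) => [r| |] // bound r_ge0 r_neq0.
  exists (r * (expR (- 2 * gamma) / q%:R) ^+ (L - 1)).
    rewrite mulr_gt0// lt_neqAle -lee_fin r_ge0 andbT eq_sym.
    by apply/eqP => r0; rewrite r0 in r_neq0.
  by move=> x /bound; rewrite -EFinM lee_fin mulrA.
(* For an infinite constant, finiteness of the energy forces the norm to vanish on [X], so any
   positive rho would do. *)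
exists 1 => // x /bound; rewrite mul1r.
have [->|n0] := eqVneq (norm_inf2 (subvec (maximal_targets i) x)) 0.
  by rewrite expr0n /= mulr0 mule0 lee_fin.
rewrite mulyr gtr0_sg ?mul1e ?leye_eq// mulr_gt0// lt_neqAle sqr_ge0 andbT.
by rewrite eq_sym sqrf_eq0.
Qed.
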